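(* Let $a<b$ be real, $1\le m<n$ integers, $s:\{0,\ldots,m\}\to\{0,\ldots,n\}$ injective, and $f\in C([a,b])$. Then \[ \|Q_sf\|_{[a,b]}\le\|A\|_\infty\,\|M_n^{-1}\|_\infty\,\|f\|_{[a,b]} \] and \[ \|f-Q_sf\|_{[a,b]}\le(1+\|Q_s\|)\,d(f,\mathcal{P}_m)_{[a,b]}. \]
   Context: $\mathcal{P}_n$ is the space of real polynomials of degree at most $n$; $\|f\|_{[a,b]}=\max_{x\in[a,b]}|f(x)|$; $d(f,\mathcal{P}_m)_{[a,b]}=\inf_{p\in\mathcal{P}_m}\|f-p\|_{[a,b]}$; $\|\cdot\|_\infty$ on matrices is the maximum absolute row sum norm; $\|Q_s\|$ is the operator norm of $Q_s$ on $(C([a,b]),\|\cdot\|_{[a,b]})$. Bernstein basis on $[a,b]$: $B^n=[B^n_0,\ldots,B^n_n]$, $B_i^n(t)=\binom{n}{i}\left(\frac{b-t}{b-a}\right)^{n-i}\left(\frac{t-a}{b-a}\right)^i$. $E$ is the degree elevation matrix, $E(i,j)=\binom{n-i}{m-j}\binom{i}{j}/\binom{n}{m}$ for $0\le i\le n$, $0\le j\le m$ (zero if $i<j$ or $n-i<m-j$), so $B^m=B^nE$. $E(s,:)$ is the (invertible) matrix with entries $E(s(i),j)$, $0\le i,j\le m$, $A=E(s,:)^{-1}$, and $D^m=B^mA=[D^m_0,\ldots,D^m_m]$. With $\xi_i^n=a+\frac{i}{n}(b-a)$, $M_n$ is the (invertible) matrix with entries $M_n(i,j)=B^n_j(\xi^n_i)$,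 $0\le i,j\le n$. The functionals $\tilde\Lambda^n=[\tilde\lambda^n_0,\ldots,\tilde\lambda^n_n]$ on $C([a,b])$ are $\tilde\lambda^n_jf=\sum_{i=0}^n M_n^{-1}(j,i)f(\xi_i^n)$. The operator is $Q_sf=\sum_{i=0}^m(\tilde\lambda^n_{s(i)}f)\,D^m_i$. *)

(* Defs.v *)
From HB Require Import structures.
From mathcomp Require Import all_boot all_order all_algebra.
From mathcomp Require Import all_classical all_reals all_analysis.
Set Implicit Arguments.
Unset Strict Implicit.
Unset Printing Implicit Defensive.
Import Order.TTheory GRing.Theory Num.Theory.
Import numFieldNormedType.Exports.
Local Open Scope classical_set_scope.
Local Open Scope ring_scope.

(** Elements of C([a,b]) are represented by functions [f : R -> R] satisfying
    [{within `[a, b], continuous f}]; everything below depends only on the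
    values of [f] on [a,b]. *)

Section UniformNorm.
Variables (R : realType) (a b : R).

(** For [a <= b] and continuous [f] the supremum is a maximum, see
    [uniform_norm_max]. *)
Definition uniform_norm (f : R -> R) : R := sup [set `|f x| | x in `[a, b]].

Lemma uniform_norm_max (f : R -> R) : a <= b -> {within `[a, b], continuous f} ->
  exists2 c, c \in `[a, b] &
    uniform_norm f = `|f c| /\ forall x, x \in `[a, b] -> `|f x| <= `|f c|.
Proof.
move=> ab cf.
have cn : {within `[a, b], continuous (fun x => `|f x|)}.
  by move=> x; apply: cvg_norm; exact: cf.
have [c cab cmax] := EVT_max ab cn.
exists c => //; split => //; apply/eqP; rewrite eq_le; apply/andP; split.
- apply: ge_sup; first by exists `|f c|, c.
  by move=> _ [x xab <-]; exact: cmax.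
- apply: ub_le_sup; last by exists c.
  by exists `|f c| => _ [x xab <-]; exact: cmax.
Qed.

Definition poly_dist (m : nat) (f : R -> R) : R :=
  inf [set uniform_norm (fun x => f x - p.[x]) |
        p in [set p : {poly R} | (size p <= m.+1)%N]].

(** Operator norm on (C([a,b]), [uniform_norm]); meaningful only for bounded
    operators, since [sup] of an unbounded set is [0]. *)
Definition operator_norm (T : (R -> R) -> (R -> R)) : R :=
  sup [set uniform_norm (T g) | g in
        [set g : R -> R | {within `[a, b], continuous g} /\ uniform_norm g <= 1]].

End UniformNorm.

Definition row_sum_norm (R : realType) (p q : nat) (A : 'M[R]_(p, q)) : R :=
  \big[Num.max/0]_(i < p) \sum_(j < q) `|A i j|.

Section Quasiinterpolation.
Variables (R : realType) (a b : R).

Definition bernstein (n i : nat) (t : R) : R :=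
  'C(n, i)%:R * ((b - t) / (b - a)) ^+ (n - i) * ((t - a) / (b - a)) ^+ i.

(** Binomial coefficients vanish when [i < j] or [n - i < m - j]. *)
Definition elevation_mx (m n : nat) : 'M[R]_(n.+1, m.+1) :=
  \matrix_(i, j) ('C(n - i, m - j)%:R * 'C(i, j)%:R / 'C(n, m)%:R).

Definition node (n i : nat) : R := a + i%:R / n%:R * (b - a).

Definition collocation_mx (n : nat) : 'M[R]_n.+1 :=
  \matrix_(i, j) bernstein n j (node n i).

(** [invmx] is the identity on singular matrices, but the collocation matrix is
    invertible for [a < b] and [0 < n], and the matrix [E(s,:)] inverted in
    [elevation_inv] is invertible for [m <= n] and [s] injective. *)
Definition functional (n : nat) (j : 'I_n.+1) (f : R -> R) : R :=
  \sum_(i < n.+1) invmx (collocation_mx n) j i * f (node n i).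

Variables (m n : nat) (s : 'I_m.+1 -> 'I_n.+1).

Definition elevation_inv : 'M[R]_m.+1 := invmx (rowsub s (elevation_mx m n)).

Definition D_basis (i : 'I_m.+1) (t : R) : R :=
  ((\row_(j < m.+1) bernstein m j t) *m elevation_inv) 0 i.

Definition quasi_interp (f : R -> R) : R -> R :=
  fun t => \sum_(i < m.+1) functional (s i) f * D_basis i t.

End Quasiinterpolation.

(* Main.v *)
Require Import Defs.
From HB Require Import structures.
From mathcomp Require Import all_boot all_order all_algebra.
From mathcomp Require Import all_classical all_reals all_analysis.
From mathcomp Require Import ring zify.
Set Implicit Arguments.
Unset Strict Implicit.
Unset Printing Implicit Defensive.
Import Order.TTheory GRing.Theory Num.Theory.
Import numFieldNormedType.Exports.
Local Open Scope classical_set_scope.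
Local Open Scope ring_scope.
(** The first bound holds because the Bernstein polynomials are nonnegative and
    sum to 1 on [a,b].  The second is the Lebesgue argument
    [f - Q f = (f - p) - Q (f - p)], which needs [Q p = p] for [p] of degree at
    most [m]: if [p = B^m c = B^n E c], the functionals return the entries of
    [E c], and [A] recovers [c] from the rows of [E c] selected by [s].  Both
    matrices are invertible because a kernel vector yields a polynomial with too
    many roots: for the collocation matrix after the substitution
    [v = u / (1 - u)], and for [E(s,:)] because [E(i,j)] is a polynomial of
    degree [m] in [i]. *)

Lemma unitmx_ker0 (R : fieldType) (n : nat) (A : 'M[R]_n) :
  (forall v : 'cV[R]_n, A *m v = 0 -> v = 0) -> A \in unitmx.
Proof.
move=> Aker; rewrite -unitmx_tr -row_free_unit -kermx_eq0.
apply/rowV0P => u /sub_kermxP uA.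
apply: trmx_inj; rewrite trmx0; apply: Aker.
by rewrite -[A]trmxK -trmx_mul uA trmx0.
Qed.

(** * Bounds for the uniform norm *)

Section UniformNormTheory.
Variables (R : realType) (a b : R).
Hypothesis hab : a <= b.
Implicit Types f g : R -> R.

Lemma uniform_norm_le f (C : R) :
  (forall x, x \in `[a, b] -> `|f x| <= C) -> uniform_norm a b f <= C.
Proof.
move=> fC; apply: ge_sup => [|_ [x xab <-]]; last exact: fC.
by exists `|f a|, a => //=; rewrite in_itv/= lexx.
Qed.

(** The constant [C] only makes the set of values bounded above, so the lemma applies to
    [quasi_interp a b s f] without a continuity proof. *)
Lemma le_uniform_norm f (C : R) x : (forall y, y \in `[a, b] -> `|f y| <= C) ->
  x \in `[a, b] -> `|f x| <= uniform_norm a b f.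
Proof.
move=> fC xab; apply: ub_le_sup; last by exists x.
by exists C => _ [y yab <-]; exact: fC.
Qed.

Lemma continuous_le_uniform_norm f x : {within `[a, b], continuous f} ->
  x \in `[a, b] -> `|f x| <= uniform_norm a b f.
Proof.
by move=> /(uniform_norm_max hab)[c _ [-> fc]]; exact: fc.
Qed.

Lemma uniform_norm_ge0 f : {within `[a, b], continuous f} ->
  0 <= uniform_norm a b f.
Proof. by move=> /(uniform_norm_max hab)[c _ [-> _]]. Qed.

End UniformNormTheory.

Lemma ler_row_sum_norm (R : realType) (p q : nat) (A : 'M[R]_(p, q)) i :
  \sum_(j < q) `|A i j| <= row_sum_norm A.
Proof. exact: (le_bigmax _ (fun i => \sum_(j < q) `|A i j|)). Qed.

Lemma row_sum_norm_ge0 (R : realType) (p q : nat) (A : 'M[R]_(p, q)) :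
  0 <= row_sum_norm A.
Proof. exact: bigmax_ge_id. Qed.

Lemma sum_mul_le_row_sum_norm (R : realType) (p q : nat) (A : 'M[R]_(p, q)) i
    (x : 'I_q -> R) (C : R) :
  (forall j, `|x j| <= C) -> 0 <= C ->
  `|\sum_(j < q) A i j * x j| <= row_sum_norm A * C.
Proof.
move=> xC C0; apply: le_trans (ler_norm_sum _ _ _) _.
apply: le_trans (ler_wpM2r C0 (ler_row_sum_norm A i)).
by rewrite mulr_suml ler_sum// => j _; rewrite normrM ler_wpM2l.
Qed.

(** * Bernstein basis, degree elevation and interpolation at the nodes *)

Section BernsteinTheory.
Variables (R : realType) (a b : R).
Hypothesis hab : a < b.

Let ba0 : b - a != 0. Proof. by rewrite subr_eq0 gt_eqF. Qed.

Lemma bernstein_ge0 n i t : t \in `[a, b] -> 0 <= bernstein a b n i t.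
Proof.
rewrite in_itv/= => /andP[at_ tb].
by rewrite /bernstein !mulr_ge0// ?exprn_ge0// divr_ge0// subr_ge0// ltW.
Qed.


Lemma node_subl n i : node a b n i - a = i%:R / n%:R * (b - a).
Proof. by rewrite /node; ring. Qed.

Lemma node_subr n i : (0 < n)%N -> (i <= n)%N ->
  b - node a b n i = (n - i)%:R / n%:R * (b - a).
Proof.
move=> n0 le_in; have n0' : n%:R != 0 :> R by rewrite pnatr_eq0 -lt0n.
by rewrite /node natrB//; field.
Qed.

Lemma node_itv n i : (0 < n)%N -> (i <= n)%N -> node a b n i \in `[a, b].
Proof.
move=> n0 le_in; rewrite in_itv/= -subr_ge0 -[X in _ && X]subr_ge0.
by rewrite node_subl node_subr// !mulr_ge0 ?divr_ge0// subr_ge0 ltW.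
Qed.

Lemma node_inj n i j : (0 < n)%N -> node a b n i = node a b n j -> i = j.
Proof.
move=> n0 /(congr1 (fun t => t - a)); rewrite !node_subl => /(mulIf ba0).
have n0' : n%:R^-1 != 0 :> R by rewrite invr_eq0 pnatr_eq0 -lt0n.
by move=> /(mulIf n0') /eqP; rewrite eqr_nat => /eqP.
Qed.

Lemma bernstein_node n i j : (0 < n)%N -> (i <= n)%N ->
  bernstein a b n j (node a b n i) =
  'C(n, j)%:R * ((n - i)%:R / n%:R) ^+ (n - j) * (i%:R / n%:R) ^+ j.
Proof. by move=> n0 le_in; rewrite /bernstein node_subl node_subr// !mulfK. Qed.

(** Both sides count pairs of subsets of an [n]-set, of sizes [i] and [m], that meet in [j] points.
    The test [j <= i] is needed because truncated subtraction would otherwise give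
    ['C(n - m, 0) = 1]. *)
Lemma bin_elevation m n i j : (j <= m <= n)%N -> (i <= n)%N ->
  ('C(n, i) * 'C(n - i, m - j) * 'C(i, j) =
   'C(n, m) * 'C(m, j) * (if j <= i then 'C(n - m, i - j) else 0))%N.
Proof.
move=> /andP[le_jm le_mn] le_in; case: leqP => [le_ji|lt_ij]; last first.
  by rewrite (bin_small lt_ij) !muln0.
have [le_ijnm|lt_nmij] := leqP (i - j) (n - m); last first.
  by rewrite (bin_small lt_nmij) muln0 (@bin_small (n - i)) ?muln0//; lia.
have le_mjni : (m - j <= n - i)%N by lia.
have e : (n - i - (m - j) = n - m - (i - j))%N by lia.
(* Each side times [j! (m-j)! (i-j)! (n-m-(i-j))!] equals [n!]; this positive product is then
   cancelled. *)
have := bin_fact le_in; have := bin_fact le_mjni; have := bin_fact le_ji.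
have := bin_fact le_mn; have := bin_fact le_jm; have := bin_fact le_ijnm.
rewrite e => <- <- h3 <- h2 h1; rewrite -h3 -h2 in h1.
have := fact_gt0 (n - m - (i - j)); have := fact_gt0 (i - j).
have := fact_gt0 (m - j); have := fact_gt0 j.
move: h1.
set f1 := (j`!)%N; set f2 := ((m - j)`!)%N; set f3 := ((i - j)`!)%N.
set f4 := ((_ - _)`!)%N => h f10 f20 f30 f40.
have f0 : (0 < f1 * f2 * f3 * f4)%N by rewrite !muln_gt0 f10 f20 f30.
apply/eqP; rewrite -(eqn_pmul2r f0); apply/eqP.
by nia.
Qed.

(** With [x + y = 1], multiply the left side by [(x + y) ^+ (n - m)] and expand; [bin_elevation]
    matches the coefficients. *)
Lemma bernstein_elevation m n j t : (j <= m <= n)%N ->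
  bernstein a b m j t = \sum_(i < n.+1) bernstein a b n i t *
    ('C(n - i, m - j)%:R * 'C(i, j)%:R / 'C(n, m)%:R).
Proof.
move=> jmn; have /andP[le_jm le_mn] := jmn; rewrite /bernstein.
set x := (b - t) / (b - a); set y := (t - a) / (b - a).
have xy1 : x + y = 1 by rewrite /x /y; field.
have nm0 : 'C(n, m)%:R != 0 :> R by rewrite pnatr_eq0 -lt0n bin_gt0.
transitivity (\sum_(i < n.+1)
    'C(m, j)%:R * (if (j <= i)%N then 'C(n - m, i - j) else 0)%:R *
    (x ^+ (n - i) * y ^+ i)); last first.
  apply: eq_bigr => i _; apply: (mulIf nm0).
  have := congr1 (fun k : nat => k%:R : R) (bin_elevation jmn (ltn_ord i : i <= n)%N).
  rewrite !natrM => e.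
  transitivity ('C(n, m)%:R * 'C(m, j)%:R * (if (j <= i)%N then 'C(n - m, i - j) else 0)%:R
    * (x ^+ (n - i) * y ^+ i)); first by ring.
  by rewrite -e; field.
pose F i := 'C(m, j)%:R * (if (j <= i)%N then 'C(n - m, i - j) else 0)%:R *
  (x ^+ (n - i) * y ^+ i).
(* Only indices from [j] to [j + (n - m)] contribute: terms below vanish by the test in [F], terms
   above by the binomial coefficient. What remains is shifted by [j]. *)
rewrite -(big_mkord xpredT F) (@big_cat_nat _ _ _ j)//=; last by lia.
rewrite big_nat big1 ?add0r; last first.
  by move=> i /andP[_ lt_ij]; rewrite /F leqNgt lt_ij /= mulr0 mul0r.
rewrite (_ : \sum_(j <= i < n.+1) F i = \sum_(0 <= i < n.+1 - j) F (i + j)%N);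
  last by rewrite -(big_addn 0 n.+1 j xpredT F) add0n.
rewrite (@big_cat_nat _ _ _ (n - m).+1)//=; last by lia.
rewrite [X in _ + X]big_nat [X in _ + X]big1 ?addr0; last first.
  by move=> i /andP[lt_nmi _]; rewrite /F leq_addl addnK (bin_small lt_nmi) mulr0 mul0r.
have -> : 'C(m, j)%:R * x ^+ (m - j) * y ^+ j =
    'C(m, j)%:R * x ^+ (m - j) * y ^+ j * (x + y) ^+ (n - m).
  by rewrite xy1 expr1n mulr1.
rewrite exprDn mulr_sumr big_mkord; apply: eq_bigr => i _.
have le_inm : (i <= n - m)%N by rewrite -ltnS.
rewrite /F leq_addl addnK exprD.
have -> : (n - (i + j) = (m - j) + (n - m - i))%N by lia.
by rewrite exprD -mulr_natr; ring.
Qed.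

(** Obtained by elevating the constant [B^0_0 = 1] to degree [n]. *)
Lemma bernstein_sum n t : \sum_(i < n.+1) bernstein a b n i t = 1.
Proof.
transitivity (bernstein a b 0 0 t); last by rewrite /bernstein bin0 !expr0 !mulr1.
rewrite (@bernstein_elevation 0 n 0)//; apply: eq_bigr => i _.
by rewrite !bin0 divr1 !mulr1.
Qed.

Lemma collocation_mx_unit n : (0 < n)%N -> collocation_mx a b n \in unitmx.
Proof.
move=> n0; apply: unitmx_ker0 => c Mc0.
have n0' : n%:R != 0 :> R by rewrite pnatr_eq0 -lt0n.
have row0 (i : 'I_n.+1) : \sum_(j < n.+1) 'C(n, j)%:R *
    ((n - i)%:R / n%:R) ^+ (n - j) * (i%:R / n%:R) ^+ j * c j 0 = 0.
  have /matrixP/(_ i 0) := Mc0; rewrite !mxE => row_i; rewrite -[RHS]row_i.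
  by apply: eq_bigr => j _; rewrite mxE bernstein_node// -ltnS.
have cmax0 : c ord_max 0 = 0.
  have := row0 ord_max; rewrite big_ord_recr/= subnn divff// big1 ?add0r.
    by rewrite binn expr1n expr0 !mul1r.
  by move=> j _; rewrite /= mul0r expr0n subn_eq0 leqNgt ltn_ord/= mulr0 !mul0r.
(* The row at node [b] forces [c_n = 0]; dividing row [k < n] by [(1 - u)^n]
   makes it the value of [p] at [v k = u / (1 - u)], where [u = k / n]. *)
pose p := \poly_(j < n) ('C(n, j)%:R * c (inord j) 0).
pose v k : R := k%:R / (n - k)%:R.
have p0 : p = 0.
  apply: (@roots_geq_poly_eq0 _ _ [seq v k | k <- iota 0 n]).
  - apply/allP => _ /mapP[k + ->]; rewrite mem_iota add0n => /andP[_ lt_kn].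
    have nk0 : (n - k)%:R != 0 :> R by rewrite pnatr_eq0 subn_eq0 -ltnNge.
    have x0 : (n - k)%:R / n%:R != 0 :> R by rewrite mulf_neq0// invr_eq0.
    have := row0 (inord k); rewrite inordK; last by rewrite ltnS ltnW.
    rewrite big_ord_recr/= cmax0 mulr0 addr0 => sum0.
    apply/rootP; apply: (mulfI (expf_neq0 n x0)); rewrite mulr0 -[RHS]sum0.
    rewrite horner_poly mulr_sumr; apply: eq_bigr => j _.
    have -> : inord j = widen_ord (leqnSn n) j.
      by apply: val_inj; rewrite /= inordK// ltnS ltnW.
    set x := (n - k)%:R / n%:R in x0 *; set y := k%:R / n%:R.
    have -> : v k = y / x by rewrite /v /x /y; field; rewrite n0' nk0.
    have -> : x ^+ n = x ^+ (n - j) * x ^+ j by rewrite -exprD subnK// ltnW.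
    by rewrite [(y / x) ^+ j]expr_div_n; field; rewrite expf_neq0.
  (* The points are distinct: cross-multiplying [v k = v l] gives [k (n - l) = l (n - k)], hence
     [k = l]. *)
  - rewrite map_inj_in_uniq ?iota_uniq// => k l.
    rewrite !mem_iota !add0n => /andP[_ lt_kn] /andP[_ lt_ln] /eqP.
    rewrite eqr_div ?pnatr_eq0 ?subn_eq0 -?ltnNge// -!natrM eqr_nat => /eqP.
    by nia.
  - by rewrite size_map size_iota size_poly.
apply/matrixP => i z; rewrite ord1 mxE; case: (ltnP i n) => [lt_in|le_ni].
  have := congr1 (fun q : {poly R} => q`_i) p0; rewrite coef_poly lt_in coef0 inord_val.
  by move/eqP; rewrite mulf_eq0 pnatr_eq0 -leqn0 leqNgt bin_gt0 (ltnW lt_in)/= => /eqP.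
rewrite -[RHS]cmax0; congr (c _ _); apply: val_inj => /=.
by apply/eqP; rewrite eqn_leq le_ni -ltnS ltn_ord.
Qed.

Definition bernstein_poly n i : {poly R} :=
  'C(n, i)%:R *: (((b - a)^-1 *: (b%:P - 'X)) ^+ (n - i) *
                  ((b - a)^-1 *: ('X - a%:P)) ^+ i).

Lemma horner_bernstein_poly n i t : (bernstein_poly n i).[t] = bernstein a b n i t.
Proof.
by rewrite !hornerE /bernstein /= [(b - t) / _]mulrC [(t - a) / _]mulrC.
Qed.

Lemma size_bernstein_poly n i : (i <= n)%N -> (size (bernstein_poly n i) <= n.+1)%N.
Proof.
move=> le_in; apply: leq_trans (size_scale_leq _ _) _.
have size_pow (p : {poly R}) k : (size p <= 2)%N -> (size (p ^+ k) <= k.+1)%N.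
  move=> sp; apply: leq_trans (size_poly_exp_leq _ _) _.
  by rewrite ltnS; case: (size p) sp => [|[|[|]]]//= _; lia.
apply: leq_trans (size_polyMleq _ _) _.
have s1 : (size ((b - a)^-1 *: (b%:P - 'X)) <= 2)%N.
  by apply: leq_trans (size_scale_leq _ _) _; rewrite -opprB size_polyN size_XsubC.
have s2 : (size ((b - a)^-1 *: ('X - a%:P)) <= 2)%N.
  by apply: leq_trans (size_scale_leq _ _) _; rewrite size_XsubC.
have add_le (u v : nat) : (u <= (n - i).+1 -> v <= i.+1 -> (u + v).-1 <= n.+1)%N by lia.
by apply: add_le; exact: size_pow.
Qed.

(** The coefficients solve the interpolation problem at the nodes. The difference [q] then has size
    at most [n + 1] and [n + 1] distinct roots, so it is zero. *)
Lemma bernstein_expansion n (p : {poly R}) : (0 < n)%N -> (size p <= n.+1)%N ->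
  exists c : 'cV[R]_n.+1, forall t, p.[t] = \sum_(j < n.+1) bernstein a b n j t * c j 0.
Proof.
move=> n0 sp; pose c := invmx (collocation_mx a b n) *m \col_i p.[node a b n i].
exists c; pose q := p - \sum_(j < n.+1) c j 0 *: bernstein_poly n j.
have qE t : q.[t] = p.[t] - \sum_(j < n.+1) bernstein a b n j t * c j 0.
  rewrite !hornerE horner_sum; congr (_ - _); apply: eq_bigr => j _.
  by rewrite hornerZ horner_bernstein_poly mulrC.
suff q0 : q = 0 by move=> t; apply/eqP; rewrite -subr_eq0 -qE q0 horner0.
apply: (@roots_geq_poly_eq0 _ _ [seq node a b n i | i <- iota 0 n.+1]).
- apply/allP => _ /mapP[k + ->]; rewrite mem_iota add0n => /andP[_ lt_kn].
  have /matrixP/(_ (Ordinal lt_kn) 0) : collocation_mx a b n *m c = \col_i p.[node a b n i].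
    by rewrite mulmxA mulmxV ?mul1mx// collocation_mx_unit.
  rewrite !mxE/= => pk; apply/rootP; rewrite qE -pk; apply/eqP.
  by rewrite subr_eq0; apply/eqP/eq_bigr => j _; rewrite mxE.
- by rewrite map_inj_uniq ?iota_uniq// => i j; exact: node_inj.
- rewrite size_map size_iota; apply: leq_trans (size_polyD _ _) _.
  rewrite size_polyN geq_max sp/=; apply: leq_trans (size_sum _ _ _) _.
  apply/bigmax_leqP => j _; apply: leq_trans (size_scale_leq _ _) _.
  by rewrite size_bernstein_poly// -ltnS.
Qed.

End BernsteinTheory.

(** * Invertibility of the selected rows of the elevation matrix *)

Section Elevation.
Variable R : realType.

(** The binomial coefficient as a polynomial in its upper argument, written as a falling factorial
    over [k!]. *)
Definition bin_poly k : {poly R} :=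
  k`!%:R^-1 *: \prod_(l <- iota 0 k) ('X - l%:R%:P).

Lemma horner_bin_poly k i : (bin_poly k).[i%:R] = 'C(i, k)%:R.
Proof.
have k0 : k`!%:R != 0 :> R by rewrite pnatr_eq0 -lt0n fact_gt0.
apply: (mulfI k0); rewrite hornerZ mulVKf// mulrC -natrM bin_ffact {k0}.
elim: k => [|k IHk]; first by rewrite big_nil hornerE.
rewrite -addn1 iotaD add0n big_cat big_seq1 hornerM {}IHk addn1 ffactnSr natrM.
(* For [i < k] the natural number [i - k] is truncated, but the falling factorial in front of it is
   already zero. *)
rewrite !hornerE; have [lt_ik|le_ki] := ltnP i k; last by rewrite natrB.
by rewrite ffact_small ?mul0r.
Qed.

Lemma size_bin_poly k : (size (bin_poly k) <= k.+1)%N.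
Proof.
by apply: leq_trans (size_scale_leq _ _) _; rewrite size_prod_XsubC size_iota.
Qed.

Lemma rowsub_elevation_mx_unit m n (s : 'I_m.+1 -> 'I_n.+1) :
  (m <= n)%N -> injective s -> rowsub s (elevation_mx R m n) \in unitmx.
Proof.
move=> le_mn s_inj; apply: unitmx_ker0 => c Ec0.
have nm0 : 'C(n, m)%:R != 0 :> R by rewrite pnatr_eq0 -lt0n bin_gt0.
(* At each integer [i <= n], [q] takes the value of row [i] of [E c] times ['C(n, m)]; it therefore
   vanishes at the [m + 1] distinct integers [s i], while its degree is at most [m]. *)
pose q := \sum_(j < m.+1) c j 0 *: (bin_poly j * (bin_poly (m - j) \Po (n%:R%:P - 'X))).
have qE i : (i <= n)%N ->
    q.[i%:R] = \sum_(j < m.+1) 'C(n - i, m - j)%:R * 'C(i, j)%:R * c j 0.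
  move=> le_in; rewrite horner_sum; apply: eq_bigr => j _.
  rewrite hornerZ hornerM horner_comp hornerD hornerN hornerX hornerC.
  rewrite -natrB// !horner_bin_poly.
  by rewrite mulrC ['C(i, j)%:R * _]mulrC.
have q0 : q = 0.
  apply: (@roots_geq_poly_eq0 _ _ [seq (s i)%:R | i <- enum 'I_m.+1]).
  - apply/allP => _ /mapP[i _ ->]; apply/rootP; rewrite qE -1?ltnS//.
    apply: (mulIf (invr_neq0 nm0)); rewrite mul0r.
    have /matrixP/(_ i 0) := Ec0; rewrite !mxE => row_i; rewrite -[RHS]row_i.
    by rewrite mulr_suml; apply: eq_bigr => j _; rewrite !mxE; ring.
  - rewrite map_inj_uniq ?enum_uniq// => i j /eqP.
    by rewrite eqr_nat => /eqP/val_inj/s_inj.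
  - rewrite size_map size_enum_ord; apply: leq_trans (size_sum _ _ _) _.
    apply/bigmax_leqP => j _; apply: leq_trans (size_scale_leq _ _) _.
    apply: leq_trans (size_polyMleq _ _) _.
    have add_le (u v : nat) : (u <= j.+1 -> v <= (m - j).+1 -> (u + v).-1 <= m.+1)%N.
      by have := ltn_ord j; lia.
    apply: add_le; first exact: size_bin_poly.
    apply: leq_trans (size_comp_poly_leq _ _) _.
    rewrite -opprB size_polyN size_XsubC muln1 ltnS.
    by have := size_bin_poly (m - j); case: (size _).
(* Evaluating [q] at [i = 0, ..., m] gives a triangular system for [c]. *)
suff c0 k : forall i : 'I_m.+1, i = k :> nat -> c i 0 = 0.
  by apply/matrixP => i z; rewrite ord1 mxE (c0 i).
elim/ltn_ind: k => k IHk i ik; have le_im : (i <= m)%N by rewrite -ltnS.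
have le_in : (i <= n)%N := leq_trans le_im le_mn.
have := qE i le_in; rewrite q0 horner0 (bigD1 i)//= big1 ?addr0; last first.
  move=> j; rewrite neq_ltn => /orP[lt_ji|lt_ij].
    by rewrite (IHk j) ?mulr0// -ik.
  by rewrite (bin_small lt_ij) mulr0 mul0r.
(* The diagonal coefficient ['C(n - i, m - i)] is nonzero because [m <= n]. *)
move/esym/eqP; rewrite binn mulr1 mulf_eq0 pnatr_eq0 -leqn0 leqNgt bin_gt0.
by rewrite leq_sub2r//= => /eqP.
Qed.

End Elevation.

(** * Bounds and polynomial reproduction for the quasi-interpolant *)

Section QuasiInterpTheory.
Variables (R : realType) (a b : R) (m n : nat) (s : 'I_m.+1 -> 'I_n.+1).
Hypotheses (hab : a < b) (n0 : (0 < n)%N).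
Implicit Types f g : R -> R.

(** Collecting the Bernstein polynomials makes the value at [t] in [[a, b]] a convex combination of
    coefficients, which gives the norm bound and allows comparison with a Bernstein expansion. *)
Lemma quasi_interp_mxE f t : quasi_interp a b s f t =
  \sum_(j < m.+1) bernstein a b m j t *
    \sum_(i < m.+1) elevation_inv R s j i * functional a b (s i) f.
Proof.
under [RHS]eq_bigr do rewrite mulr_sumr.
rewrite exchange_big; apply: eq_bigr => i _ /=.
rewrite /D_basis !mxE mulr_sumr; apply: eq_bigr => j _.
by rewrite !mxE; ring.
Qed.

Lemma quasi_interpZ (k : R) f t :
  quasi_interp a b s (fun x => k * f x) t = k * quasi_interp a b s f t.
Proof.
rewrite mulr_sumr; apply: eq_bigr => i _; rewrite mulrA; congr (_ * _).
by rewrite mulr_sumr; apply: eq_bigr => j _; rewrite mulrCA.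
Qed.

Lemma quasi_interpB f g t : quasi_interp a b s (fun x => f x - g x) t =
  quasi_interp a b s f t - quasi_interp a b s g t.
Proof.
rewrite -sumrB; apply: eq_bigr => i _; rewrite -mulrBl; congr (_ * _).
by rewrite -sumrB; apply: eq_bigr => j _; rewrite mulrBr.
Qed.

Lemma quasi_interp_bound f (C : R) t : 0 <= C ->
  (forall x, x \in `[a, b] -> `|f x| <= C) -> t \in `[a, b] ->
  `|quasi_interp a b s f t| <=
    row_sum_norm (elevation_inv R s) *
    row_sum_norm (invmx (collocation_mx a b n)) * C.
Proof.
move=> C0 fC tab; set K := (X in _ <= X); rewrite quasi_interp_mxE.
apply: le_trans (ler_norm_sum _ _ _) _.
(* [K] is spread over the Bernstein weights, so it suffices to bound each coefficient: one row-sum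
   estimate for [A], one for the inverse collocation matrix. *)
rewrite -[K]mul1r -(bernstein_sum hab m t) mulr_suml; apply: ler_sum => j _.
rewrite normrM ger0_norm ?bernstein_ge0// ler_wpM2l ?bernstein_ge0// /K -mulrA.
apply: sum_mul_le_row_sum_norm => [i|]; last by rewrite mulr_ge0 ?row_sum_norm_ge0.
apply: sum_mul_le_row_sum_norm => // k; apply: fC.
by rewrite node_itv// -ltnS.
Qed.

Lemma quasi_interp_poly (p : {poly R}) t : (0 < m <= n)%N -> injective s ->
  (size p <= m.+1)%N -> quasi_interp a b s (horner p) t = p.[t].
Proof.
move=> /andP[m0 le_mn] s_inj /(bernstein_expansion hab m0)[c pE].
have funcE i : functional a b i (horner p) = (elevation_mx R m n *m c) i 0.
  have -> : elevation_mx R m n *m c =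
      invmx (collocation_mx a b n) *m \col_k p.[node a b n k].
    (* The node values of [p = B^m c = B^n E c] form the vector [M_n (E c)]. *)
    rewrite (_ : \col_k _ = collocation_mx a b n *m (elevation_mx R m n *m c)).
      by rewrite mulKmx// collocation_mx_unit.
    apply/matrixP => k z; rewrite ord1 mulmxA !mxE pE; apply: eq_bigr => j _.
    congr (_ * _); rewrite mxE (@bernstein_elevation _ _ _ hab m n).
      by apply: eq_bigr => l _; rewrite !mxE.
    by rewrite le_mn -ltnS ltn_ord.
  by rewrite mxE; apply: eq_bigr => k _; rewrite mxE.
rewrite quasi_interp_mxE pE; apply: eq_bigr => j _; congr (_ * _).
have <- : elevation_inv R s *m rowsub s (elevation_mx R m n *m c) = c.
  by rewrite -mul_rowsub_mx mulKmx// rowsub_elevation_mx_unit.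
by rewrite mxE; apply: eq_bigr => i _; rewrite funcE !mxE.
Qed.

Lemma uniform_norm_quasi_interp f : {within `[a, b], continuous f} ->
  uniform_norm a b (quasi_interp a b s f) <=
    row_sum_norm (elevation_inv R s) *
    row_sum_norm (invmx (collocation_mx a b n)) * uniform_norm a b f.
Proof.
move=> cf; apply: uniform_norm_le; first exact: ltW.
move=> x xab; apply: quasi_interp_bound => //.
  by apply: uniform_norm_ge0 => //; exact: ltW.
by move=> y yab; apply: continuous_le_uniform_norm => //; exact: ltW.
Qed.

Lemma continuous_within_cst_mul (k : R) f : {within `[a, b], continuous f} ->
  {within `[a, b], continuous (fun x => k * f x)}.
Proof. by move=> cf x; apply: cvgM; [exact: cvg_cst|exact: cf]. Qed.

(** The first bound of the theorem shows that the set defining [operator_norm] is bounded above, so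
    its [sup] is a genuine upper bound. *)
Let le_op_norm f : {within `[a, b], continuous f} -> uniform_norm a b f <= 1 ->
  uniform_norm a b (quasi_interp a b s f) <= operator_norm a b (quasi_interp a b s).
Proof.
move=> cf f1; apply: ub_le_sup; last by exists f.
exists (row_sum_norm (elevation_inv R s) *
    row_sum_norm (invmx (collocation_mx a b n))) => _ [g [cg g1] <-].
apply: le_trans (uniform_norm_quasi_interp cg) _.
by rewrite -[leRHS]mulr1 ler_wpM2l// mulr_ge0 ?row_sum_norm_ge0.
Qed.

(** By linearity, rescale [f] to norm at most 1. *)
Lemma quasi_interp_le_operator_norm f t : {within `[a, b], continuous f} ->
  t \in `[a, b] -> `|quasi_interp a b s f t| <=
    operator_norm a b (quasi_interp a b s) * uniform_norm a b f.
Proof.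
move=> cf tab; have lab := ltW hab.
have f0 := uniform_norm_ge0 lab cf.
have fle y := continuous_le_uniform_norm lab cf : y \in _ -> _.
have Qfb y (yab : y \in `[a, b]) := quasi_interp_bound f0 fle yab.
(* When the norm is zero rescaling is impossible, but [Qfb] already gives the bound 0. *)
have [f_eq0|f_neq0] := eqVneq (uniform_norm a b f) 0.
  by move: (Qfb t tab); rewrite f_eq0 !mulr0.
have f_gt0 : 0 < uniform_norm a b f by rewrite lt_neqAle eq_sym f_neq0.
set N := uniform_norm a b f in f0 fle Qfb f_neq0 f_gt0 *.
have cg := continuous_within_cst_mul (k := N^-1) cf.
have g1 x : x \in `[a, b] -> `|N^-1 * f x| <= 1.
  move=> xab; rewrite normrM ger0_norm ?invr_ge0// mulrC ler_pdivrMr// mul1r.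
  exact: fle.
have Qg_op := le_op_norm cg (uniform_norm_le lab g1).
rewrite -ler_pdivrMr//; apply: le_trans Qg_op.
have -> : `|quasi_interp a b s f t| / N = `|quasi_interp a b s (fun x => N^-1 * f x) t|.
  by rewrite quasi_interpZ normrM ger0_norm ?invr_ge0// mulrC.
exact: (le_uniform_norm (fun y yab => quasi_interp_bound ler01 g1 yab)).
Qed.

(** Tested on the zero function; it makes [1 + operator_norm] positive, hence a legitimate
    divisor. *)
Lemma operator_norm_ge0 : 0 <= operator_norm a b (quasi_interp a b s).
Proof.
have c0 : {within `[a, b], continuous (fun=> 0 : R)} by move=> x; exact: cvg_cst.
have z1 : uniform_norm a b (fun=> 0 : R) <= 1.
  by apply: uniform_norm_le => [|x _]; rewrite ?normr0 ?ler01// ltW.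
apply: le_trans (le_op_norm c0 z1).
have aab : a \in `[a, b] by rewrite in_itv/= lexx ltW.
apply: le_trans (le_uniform_norm _ aab); first exact: normr_ge0.
by move=> y; apply: (quasi_interp_bound ler01) => x _; rewrite normr0 ler01.
Qed.

End QuasiInterpTheory.

Theorem theorem9p6 (R : realType) (a b : R) (m n : nat)
    (s : 'I_m.+1 -> 'I_n.+1) (f : R -> R)
    (hab : a < b) (hm : (1 <= m)%N) (hmn : (m < n)%N) (hs : injective s)
    (hf : {within `[a, b], continuous f}) :
  uniform_norm a b (quasi_interp a b s f)
    <= row_sum_norm (elevation_inv R s)
       * row_sum_norm (invmx (collocation_mx a b n))
       * uniform_norm a b f
  /\
  uniform_norm a b (fun x => f x - quasi_interp a b s f x)
    <= (1 + operator_norm a b (quasi_interp a b s)) * poly_dist a b m f.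
Proof.
have n0 : (0 < n)%N := leq_trans hm (ltnW hmn).
split; first exact: uniform_norm_quasi_interp.
have Q0 : 0 < 1 + operator_norm a b (quasi_interp a b s).
  by rewrite ltr_wpDr// operator_norm_ge0.
(* After division the claim is that the left side is a lower bound of the set of distances, so an
   arbitrary [p] suffices and no best approximation is required. The polynomial 0 shows that the set
   is nonempty. *)
rewrite mulrC -ler_pdivrMr//; apply: lb_le_inf.
  by exists (uniform_norm a b (fun x => f x - (0 : {poly R}).[x])), 0;
    rewrite //= size_poly0.
move=> _ [p /= sp <-]; rewrite ler_pdivrMr// mulrC.
have cfp : {within `[a, b], continuous (fun x => f x - p.[x])}.
  have cp : {within `[a, b], continuous (horner p)}.
    by apply: continuous_subspaceT => x; exact: continuous_horner.
  by move=> x; apply: cvgB; [exact: hf|exact: cp].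
apply: uniform_norm_le => [|x xab]; first exact: ltW.
have -> : f x - quasi_interp a b s f x =
    f x - p.[x] - quasi_interp a b s (fun y => f y - p.[y]) x.
  have hmn' : (0 < m <= n)%N by rewrite hm ltnW.
  have -> : quasi_interp a b s (fun y => f y - p.[y]) x =
      quasi_interp a b s f x - p.[x].
    by rewrite quasi_interpB (quasi_interp_poly hab n0 x hmn' hs sp).
  by rewrite opprB addrA subrK.
apply: le_trans (ler_normB _ _) _; rewrite mulrDl mul1r lerD//.
  exact: (continuous_le_uniform_norm (ltW hab) cfp xab).
exact: (quasi_interp_le_operator_norm s hab n0 cfp xab).
Qed.
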